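(* Let $\mathcal S$ be a spread of $\mathcal Q^+(7,2)$, let $\Sigma_1,\Sigma_2\in\mathcal S$ be distinct, let $G^*$ be the setwise stabiliser of $\{\Sigma_1,\Sigma_2\}$ and $\mathcal S\setminus\{\Sigma_1,\Sigma_2\}$ in $\mathrm{PGO}^+(8,2)$, and let $\mathcal Y$ be the orbit of size $120$ of $G^*$ on the ovoids of $\mathcal Q^+(7,2)$. For each anisotropic point $P$ of $\mathrm{PG}(7,2)$ there is a unique line $\ell_P$ through $P$ that intersects both $\Sigma_1$ and $\Sigma_2$, and there is a unique ovoid $\mathcal O_P\in\mathcal Y$ that contains the points $\Sigma_1\cap\ell_P$ and $\Sigma_2\cap\ell_P$. The map $P\mapsto\mathcal O_P$ is a one-to-one correspondence between the anisotropic points and the ovoids in $\mathcal Y$, and this correspondence is $G^*$-invariant, i.e. $\mathcal O_{P^g}=(\mathcal O_P)^g$ for all $g\in G^*$.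
   Context: $\mathcal Q^+(7,2)$ is the hyperbolic quadric in $\mathrm{PG}(7,2)$ defined by a non-degenerate hyperbolic quadratic form $f$ on $\mathbb F_2^8$. Points with $f\neq0$ are anisotropic (there are $120$), points with $f=0$ are isotropic. Generators are the maximal totally isotropic subspaces (projective dimension $3$). An ovoid is a set of isotropic points containing exactly one point of each generator; a spread is a set of generators partitioning the isotropic points. $\mathrm{PGO}^+(8,2)$ is the group of collineations of $\mathrm{PG}(7,2)$ induced by linear maps preserving $f$ up to a nonzero scalar. The group $G^*$ has exactly two orbits on the ovoids of $\mathcal Q^+(7,2)$, of sizes $120$ and $840$. *)

(* Defs.v *)
From HB Require Import structures.
From mathcomp Require Import all_boot all_fingroup all_algebra.

Set Implicit Arguments.
Unset Strict Implicit.
Unset Printing Implicit Defensive.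

Import GRing.Theory.
Local Open Scope ring_scope.

(* Subspaces over a finite field form a finite type, inherited from the
   canonical matrices that represent them. *)
Section FiniteVspace.

Import VectorInternalTheory.
Variables (K : finFieldType) (vT : vectType K).

HB.instance Definition _ := [Countable of {vspace vT} by <:].
HB.instance Definition _ := [Finite of {vspace vT} by <:].

End FiniteVspace.

Notation vec := 'rV['F_2]_8.

Definition point := {P : {vspace vec} | \dim P == 1%N}.

(* A projective subspace is identified with the set of its points. *)
Definition points_of (U : {vspace vec}) : {set point} :=
  [set P : point | (val P <= U)%VS].

Definition lines : {set {set point}} :=
  [set points_of U | U : {vspace vec} & \dim U == 2%N].

Section Quadric.

Variable f : vec -> 'F_2.

Definition polar (u v : vec) : 'F_2 := f (u + v) - f u - f v.

(* [polar] is symmetric, so linearity in its first argument is bilinearity. *)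
Definition quadratic_form : Prop :=
  (forall (a : 'F_2) (v : vec), f (a *: v) = a ^+ 2 * f v)
  /\ (forall (a : 'F_2) (u v w : vec),
        polar (a *: u + v) w = a * polar u w + polar v w).

(* The quadric [f = 0] has no singular point. In characteristic 2 this does not
   in general force [polar] to be non-degenerate, but it does in even dimension
   over a perfect field. *)
Definition nondegenerate_form : Prop :=
  forall u : vec, f u = 0 -> (forall v : vec, polar u v = 0) -> u = 0.

Definition totally_isotropic (U : {vspace vec}) : bool :=
  [forall v : vec, (v \in U) ==> (f v == 0)].

(* Maximal Witt index: half of the dimension 8. *)
Definition hyperbolic_form : Prop :=
  exists U : {vspace vec}, totally_isotropic U /\ \dim U = 4%N.

Definition isotropic_points : {set point} :=
  [set P : point | totally_isotropic (val P)].

Definition anisotropic_points : {set point} := ~: isotropic_points.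

Definition max_totally_isotropic (U : {vspace vec}) : bool :=
  totally_isotropic U
  && [forall W : {vspace vec},
        (totally_isotropic W && (U <= W)%VS) ==> (W == U)].

Definition generators : {set {set point}} :=
  [set points_of U | U : {vspace vec} & max_totally_isotropic U].

Definition is_ovoid (O : {set point}) : bool :=
  (O \subset isotropic_points)
  && [forall S in generators, #|O :&: S| == 1%N].

Definition is_spread (S : {set {set point}}) : bool :=
  (S \subset generators) && partition S isotropic_points.

Definition preserves_up_to_scalar (A : 'M['F_2]_8) : bool :=
  [exists c : 'F_2, (c != 0) && [forall v : vec, f (v *m A) == c * f v]].

Definition induces (A : 'M['F_2]_8) (g : {perm point}) : bool :=
  [forall P : point, val (g P) == (linfun (mulmxr A) @: val P)%VS].

Definition PGO : {set {perm point}} :=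
  [set g : {perm point} | [exists A : 'M['F_2]_8,
     [&& A \in unitmx, preserves_up_to_scalar A & induces A g]]].

(* Collineations act on the flats, as sets of points, by ['P^*]. *)
Definition Gstar (S : {set {set point}}) (S1 S2 : {set point})
    : {set {perm point}} :=
  ('N_PGO([set S1; S2] | 'P^*)
     :&: 'N_PGO(S :\: [set S1; S2] | 'P^*))%g.

Definition is_ovoid_orbit (G : {set {perm point}}) (Y : {set {set point}})
    : Prop :=
  exists2 O, is_ovoid O & Y = orbit ('P^*)%act G O.

End Quadric.

(* Main.v *)
From HB Require Import structures.
Require Import Defs.
From mathcomp Require Import all_boot all_fingroup all_algebra.

(** The two members Σ1, Σ2 of the spread are maximal totally isotropic and
disjoint, so the whole space is Σ1 ⊕ Σ2 with f(x, y) = <x, y> in dual bases,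
and each of the seven other members is the graph of an alternating 4x4 matrix.
These matrices and their pairwise differences are invertible. For two of them,
a and b, put m = a + b; then (x, y) |-> (m^-1 y, m x) preserves f, exchanges Σ1 and
Σ2, and exchanges the graphs of a and b while fixing the other five, so it lies
in G*. Seven such matrices form a star in the triangular graph T(8) on the 28
invertible alternating matrices; for each of the eight stars, products of two of
these maps are checked by computation to reach all 120 anisotropic points from
one of them, so G* is transitive on the anisotropic points.

An ovoid meets Σ1 and Σ2 in one point each, and the two points are not
perpendicular; their sum is an anisotropic point P. On Y this gives a
G*-equivariant map O |-> P, which is surjective by transitivity and hence
bijective, both sets having 120 elements. Its inverse is P |-> O_P. *)

Set Implicit Arguments.
Unset Strict Implicit.
Unset Printing Implicit Defensive.

Import GRing.Theory.

(** * Alternating 4x4 matrices over the field with two elements *)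

Definition bits4 := (bool * bool * bool * bool)%type.
Definition bits8 := (bits4 * bits4)%type.

(* The entries (a12, a13, a14, a23, a24, a34) of an alternating 4x4 matrix. *)
Definition alt4 := (bool * bool * bool * bool * bool * bool)%type.

Definition zero4 : bits4 := (false, false, false, false).

Definition add4 (x y : bits4) : bits4 :=
  let: (x1, x2, x3, x4) := x in let: (y1, y2, y3, y4) := y in
  (x1 (+) y1, x2 (+) y2, x3 (+) y3, x4 (+) y4).

Definition add8 (u v : bits8) : bits8 := (add4 u.1 v.1, add4 u.2 v.2).

Definition dot4 (x y : bits4) : bool :=
  let: (x1, x2, x3, x4) := x in let: (y1, y2, y3, y4) := y in
  x1 && y1 (+) x2 && y2 (+) x3 && y3 (+) x4 && y4.

Definition alt_add (a b : alt4) : alt4 :=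
  let: (a1, a2, a3, a4, a5, a6) := a in let: (b1, b2, b3, b4, b5, b6) := b in
  (a1 (+) b1, a2 (+) b2, a3 (+) b3, a4 (+) b4, a5 (+) b5, a6 (+) b6).

Definition alt_act (a : alt4) (x : bits4) : bits4 :=
  let: (a12, a13, a14, a23, a24, a34) := a in
  let: (x1, x2, x3, x4) := x in
  (a12 && x2 (+) a13 && x3 (+) a14 && x4,
   a12 && x1 (+) a23 && x3 (+) a24 && x4,
   a13 && x1 (+) a23 && x2 (+) a34 && x4,
   a14 && x1 (+) a24 && x2 (+) a34 && x3).

(** Its square is the determinant, so it decides invertibility. As a quadratic form in the six
    entries it is that of the Klein quadric. *)
Definition pfaffian (a : alt4) : bool :=
  let: (a12, a13, a14, a23, a24, a34) := a in
  a12 && a34 (+) a13 && a24 (+) a14 && a23.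

(* [alt_dual a] times [a] is the scalar matrix [pfaffian a]. *)
Definition alt_dual (a : alt4) : alt4 :=
  let: (a12, a13, a14, a23, a24, a34) := a in (a34, a24, a23, a14, a13, a12).

(** Writing the inverse of [m] as [alt_dual m] keeps the map directly computable; the two agree when
    [pfaffian m] holds. *)
Definition swap (m : alt4) (u : bits8) : bits8 :=
  (alt_act (alt_dual m) u.2, alt_act m u.1).

(* The orthogonal transvection along [m] for the quadratic form [pfaffian]; it
   equals [c |-> m c^-1 m], so [swap m] maps the graph of [c] to that of
   [alt_reflect m c]. *)
Definition alt_reflect (m c : alt4) : alt4 :=
  if pfaffian (alt_add m c) (+) pfaffian m (+) pfaffian c then alt_add c m
  else c.

Definition bools := [:: false; true].

Definition all4 : seq bits4 :=
  let pairs := [seq (p, q) | p <- bools, q <- bools] in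
  let triples := [seq (p, q) | p <- pairs, q <- bools] in
  [seq (p, q) | p <- triples, q <- bools].

Definition all6 : seq alt4 :=
  let quintuples := [seq (p, q) | p <- all4, q <- bools] in
  [seq (p, q) | p <- quintuples, q <- bools].

Lemma mem_all4 x : x \in all4.
Proof. by case: x => [[[[] []] []] []]. Qed.

Lemma mem_all6 a : a \in all6.
Proof. by case: a => [[[[[[] []] []] []] []] []]. Qed.

Lemma add4K x y : add4 (add4 x y) y = x.
Proof.
case: x y => [[[x1 x2] x3] x4] [[[y1 y2] y3] y4] /=.
by rewrite -!addbA !addbb !addbF.
Qed.

Lemma add4C x y : add4 x y = add4 y x.
Proof.
case: x y => [[[x1 x2] x3] x4] [[[y1 y2] y3] y4] /=.
by congr (_, _, _, _); apply: addbC.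
Qed.

Lemma add4_0 x : add4 x zero4 = x.
Proof. by case: x => [[[x1 x2] x3] x4] /=; rewrite !addbF. Qed.

Lemma add0_4 x : add4 zero4 x = x.
Proof. by rewrite add4C add4_0. Qed.

Lemma add4_eq0 x y : (add4 x y == zero4) = (x == y).
Proof.
apply/eqP/eqP => [xy0|->]; first by rewrite -[x](add4K x y) xy0 add4C add4_0.
by case: y => [[[y1 y2] y3] y4] /=; rewrite !addbb.
Qed.

Lemma bits4_ind (Q : bits4 -> Prop) :
    (forall x y, Q x -> Q y -> Q (add4 x y)) ->
    Q (true, false, false, false) -> Q (false, true, false, false) ->
    Q (false, false, true, false) -> Q (false, false, false, true) ->
  forall x, Q x.
Proof.
move=> QD Q1 Q2 Q3 Q4 x.
(* In characteristic 2 zero is the sum of a unit vector with itself. *)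
have Q0 : Q zero4 by apply: (QD _ _ Q1 Q1).
have -> : x = add4
    (add4 (x.1.1.1, false, false, false) (false, x.1.1.2, false, false))
    (add4 (false, false, x.1.2, false) (false, false, false, x.2)).
  by case: x => [[[[] []] []] []].
by apply: (QD); apply: (QD); case: x => [[[[] []] []] []].
Qed.

Lemma alt_actDl a b x :
  alt_act (alt_add a b) x = add4 (alt_act a x) (alt_act b x).
Proof.
case: a b x => [[[[[a1 a2] a3] a4] a5] a6] [[[[[b1 b2] b3] b4] b5] b6].
case=> [[[x1 x2] x3] x4] /=; rewrite !andb_addl.
by congr (_, _, _, _); rewrite [RHS]addbACA; congr (_ (+) _); apply: addbACA.
Qed.

Lemma alt_actDr a x y : alt_act a (add4 x y) = add4 (alt_act a x) (alt_act a y).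
Proof.
case: a x y => [[[[[a1 a2] a3] a4] a5] a6] [[[x1 x2] x3] x4].
case=> [[[y1 y2] y3] y4] /=; rewrite !andb_addr.
by congr (_, _, _, _); rewrite [RHS]addbACA; congr (_ (+) _); apply: addbACA.
Qed.

Lemma alt_act0 a : alt_act a zero4 = zero4.
Proof.
by case: a => [[[[[a1 a2] a3] a4] a5] a6] /=; rewrite !andbF.
Qed.

Lemma alt_act_inj a b : alt_act a =1 alt_act b -> a = b.
Proof.
case: a b => [[[[[a1 a2] a3] a4] a5] a6] [[[[[b1 b2] b3] b4] b5] b6] eq_ab.
(* Three columns already show all six entries of an alternating matrix. *)
move: (eq_ab (true, false, false, false)) (eq_ab (false, true, false, false)).
move: (eq_ab (false, false, true, false)) => /=.
by rewrite !andbT !andbF !addbF !addFb => -[_ _ ->] [_ -> ->] [-> -> ->].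
Qed.

Lemma alt_add_eq_act a b x :
  alt_act (alt_add a b) x = zero4 -> alt_act a x = alt_act b x.
Proof. by rewrite alt_actDl => /eqP; rewrite add4_eq0 => /eqP. Qed.

(** A zero Pfaffian is a zero determinant; the kernel vector comes from an exhaustive search over
    the 64 matrices. *)
Lemma pfaffian_kernel a : ~~ pfaffian a ->
  exists2 x, x != zero4 & alt_act a x = zero4.
Proof.
move=> pf_a.
have : all (fun a => pfaffian a
    || has (fun x => (x != zero4) && (alt_act a x == zero4)) all4) all6.
  by vm_compute.
move/allP/(_ a (mem_all6 a))/orP=> [|/hasP[x _ /andP[x_neq0 /eqP ax0]]].
  by rewrite (negPf pf_a).
by exists x.
Qed.

Lemma alt_dualK a x : pfaffian a -> alt_act (alt_dual a) (alt_act a x) = x.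
Proof.
have : all (fun a => pfaffian a ==> all (fun x =>
    alt_act (alt_dual a) (alt_act a x) == x) all4) all6 by vm_compute.
move/allP/(_ a (mem_all6 a))/implyP => H /H /allP/(_ x (mem_all4 x)).
by move/eqP.
Qed.

Lemma pfaffian_dual a : pfaffian (alt_dual a) = pfaffian a.
Proof. by case: a => [[[[[[] []] []] []] []] []]. Qed.

Lemma swapK m : pfaffian m -> involutive (swap m).
Proof.
move=> pf_m [x y]; rewrite /swap /= alt_dualK //; congr (_, _).
have dualK : alt_dual (alt_dual m) = m by case: m {pf_m} => [[[[[]]]]].
by rewrite -{1}dualK alt_dualK ?pfaffian_dual.
Qed.

Lemma swapD m u v : swap m (add8 u v) = add8 (swap m u) (swap m v).
Proof. by rewrite /swap /= !alt_actDr. Qed.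

(** An alternating matrix is symmetric in characteristic 2, so <m^-1 y, m x> = <y, x>. *)
Lemma dot4_swap m u : pfaffian m ->
  dot4 (swap m u).1 (swap m u).2 = dot4 u.1 u.2.
Proof.
have : all (fun m => pfaffian m ==> all (fun x => all (fun y =>
    dot4 (alt_act (alt_dual m) y) (alt_act m x) == dot4 x y) all4) all4) all6.
  by vm_compute.
move/allP/(_ m (mem_all6 m))/implyP => H /H /allP/(_ u.1 (mem_all4 _)).
by move/allP/(_ u.2 (mem_all4 _))/eqP.
Qed.

Arguments add4 : simpl never.
Arguments dot4 : simpl never.
Arguments alt_act : simpl never.

(** * The 28 invertible alternating matrices and their cliques *)

Definition alt_units : seq alt4 := filter pfaffian all6.

Lemma mem_alt_units a : (a \in alt_units) = pfaffian a.
Proof. by rewrite mem_filter mem_all6 andbT. Qed.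

(** The last clause makes the graphs correspond: [swap m] sends (x, c x) to (m^-1 c x, m x), and the
    clause places this vector on the graph of [alt_reflect m c]. *)
Lemma alt_reflectP m c : pfaffian m -> pfaffian c ->
  [/\ pfaffian (alt_reflect m c), alt_reflect m (alt_reflect m c) = c
    & forall x, alt_act m x
        = alt_act (alt_reflect m c) (alt_act (alt_dual m) (alt_act c x))].
Proof.
rewrite -!mem_alt_units.
have : all (fun m => all (fun c =>
    [&& pfaffian (alt_reflect m c), alt_reflect m (alt_reflect m c) == c
      & all (fun x => alt_act m x
          == alt_act (alt_reflect m c) (alt_act (alt_dual m) (alt_act c x)))
          all4]) alt_units) alt_units by vm_compute.
move=> /allP H m_unit; move/allP: (H m m_unit) => {}H c_unit.
have /and3P[pf_mc /eqP refK /allP ref] := H c c_unit.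
by rewrite mem_alt_units; split=> // x; apply/eqP/ref/mem_all4.
Qed.

(** A clique either skips the head or continues among its neighbours. The filtered tail is not
    structurally smaller, so the fuel [n], a bound on the length, drives the recursion. *)
Fixpoint cliques (T : Type) (e : rel T) (n : nat) (s : seq T) : seq (seq T) :=
  if n is n'.+1 then
    if s is a :: s' then
      cliques e n' s' ++ [seq a :: t | t <- cliques e n' (filter (e a) s')]
    else [:: [::]]
  else [:: [::]].

Lemma mem_cliques (T : eqType) (e : rel T) n (s t : seq T) :
  size s <= n -> subseq t s -> pairwise e t -> t \in cliques e n s.
Proof.
elim: n s t => [|n IHn] [|a s] t //=; try by move=> _ /eqP->.
rewrite ltnS mem_cat => le_s_n; case: t => [|b t].
  by rewrite IHn ?sub0seq.
have [-> sub_ts|_ sub_ts clique_t] := altP (b =P a); last by rewrite IHn.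
move=> /= /andP[e_a clique_t]; apply/orP; right.
rewrite map_f // IHn ?size_filter ?(leq_trans (count_size _ _)) //.
by rewrite subseq_filter e_a.
Qed.

Definition alt_adj a b := pfaffian (alt_add a b).

Fixpoint pair_sums (K : seq alt4) : seq alt4 :=
  if K is a :: K' then map (alt_add a) K' ++ pair_sums K' else [::].

Lemma pair_sumsP K m : uniq K -> m \in pair_sums K ->
  exists a b, [/\ a \in K, b \in K, a != b & m = alt_add a b].
Proof.
elim: K => //= a K IHK /andP[aK uniqK].
rewrite mem_cat => /orP[/mapP[b bK ->]|/(IHK uniqK)[b [c [bK cK neq_bc ->]]]].
  exists a, b; rewrite !inE eqxx bK orbT; split=> //.
  by apply: contraNneq aK => ->.
by exists b, c; rewrite !inE bK cK !orbT.
Qed.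

Lemma pairwise_uniq_in (T : eqType) (e : rel T) (s : seq T) : uniq s ->
  {in s &, forall a b, a != b -> e a b} -> pairwise e s.
Proof.
elim: s => //= a s IHs /andP[a_s uniq_s] es.
rewrite IHs ?andbT // => [|b c bs cs].
  apply/allP=> b bs; apply: es; rewrite ?inE ?eqxx ?bs ?orbT //.
  by apply: contraNneq a_s => ->.
by apply: es; rewrite inE ?bs ?cs orbT.
Qed.

(** The form is [dot4] in hyperbolic coordinates, so these are the 120 anisotropic vectors. *)
Definition nonperp : seq bits8 :=
  [seq u <- [seq (x, y) | x <- all4, y <- all4] | dot4 u.1 u.2].

Definition base8 : bits8 :=
  ((true, false, false, false), (true, false, false, false)).

Definition reflect_closed (K : seq alt4) :=
  all (fun m => all (fun c => alt_reflect m c \in K) K) (pair_sums K).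

(** Seven matrices have 21 pair sums, too few to reach 120 vectors in one step; hence products of
    two swaps. *)
Definition two_step_transitive (K : seq alt4) :=
  let M := pair_sums K in
  let reached := [seq swap m u | m <- M, u <- [seq swap m base8 | m <- M]] in
  all (mem reached) nonperp.

(* Up to order there are eight such [K], one for each star in the triangular
   graph T(8) formed by [alt_units] and [alt_adj]. The conditionals keep the
   evaluation from testing the smaller cliques. *)
Lemma kerdock_set_good K :
    subseq K alt_units -> pairwise alt_adj K -> 7 <= size K ->
  reflect_closed K /\ two_step_transitive K.
Proof.
move=> subK cliqueK sizeK.
have : all (fun K => if size K < 7 then true else
    if reflect_closed K then two_step_transitive K else false)
  (cliques alt_adj 28 alt_units) by vm_compute.
move/allP/(_ K); rewrite mem_cliques // ltnNge sizeK => /(_ isT) /=.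
by case: ifP.
Qed.

(** * Points and maximal totally isotropic subspaces *)

Local Open Scope ring_scope.

Lemma F2_cases (a : 'F_2) : a = 0 \/ a = 1.
Proof.
case: a => [[|[|n]] lt].
  by left; apply: val_inj.
  by right; apply: val_inj.
by exfalso; move: lt.
Qed.

Lemma addF2_self (V : lmodType 'F_2) (v : V) : v + v = 0.
Proof.
rewrite -[v]scale1r -scalerDl.
have -> : 1 + 1 = 0 :> 'F_2 by apply: val_inj.
exact: scale0r.
Qed.

Lemma memv_line_F2 (v w : vec) : (w \in <[v]>%VS) = (w == 0) || (w == v).
Proof.
apply/vlineP/orP => [[a ->]|[/eqP->|/eqP->]].
- by case: (F2_cases a) => ->; rewrite ?scale0r ?scale1r eqxx; [left|right].
- by exists 0; rewrite scale0r.
- by exists 1; rewrite scale1r.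
Qed.

(* Over F_2 a point contains exactly one nonzero vector. *)
Definition vec_of (P : point) : vec := vpick (val P).

Lemma vec_of_neq0 P : vec_of P != 0.
Proof. by rewrite vpick0 -dimv_eq0 (eqP (valP P)). Qed.

Lemma val_point P : val P = <[vec_of P]>%VS.
Proof.
apply/eqP; rewrite eq_sym eqEdim -memvE memv_pick dim_vline vec_of_neq0.
by rewrite (eqP (valP P)).
Qed.

Fact delta_neq0 : (delta_mx 0 0 : vec) != 0.
Proof. by apply/eqP => /matrixP/(_ 0 0)/eqP; rewrite !mxE !eqxx oner_eq0. Qed.

Fact dim_default_line : \dim <[delta_mx 0 0 : vec]> == 1%N.
Proof. by rewrite dim_vline delta_neq0. Qed.

(** The zero vector spans no point and gets the default line, which is why later lemmas ask for
    [v != 0]. *)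
Definition point_of (v : vec) : point :=
  insubd (exist (fun U : {vspace vec} => \dim U == 1%N) _ dim_default_line)
    <[v]>%VS.

Lemma point_ofK v : v != 0 -> vec_of (point_of v) = v.
Proof.
move=> v_neq0; have := vec_of_neq0 (point_of v).
have : vec_of (point_of v) \in <[v]>%VS.
  have -> : <[v]>%VS = val (point_of v) by rewrite val_insubd dim_vline v_neq0.
  exact: memv_pick.
by rewrite memv_line_F2 => /orP[/eqP->|/eqP//]; rewrite eqxx.
Qed.

Lemma vec_of_inj : injective vec_of.
Proof. by move=> P Q eqPQ; apply: val_inj; rewrite !val_point eqPQ. Qed.

Lemma vec_ofK P : point_of (vec_of P) = P.
Proof. by apply: vec_of_inj; rewrite point_ofK ?vec_of_neq0. Qed.

Lemma in_points_of (U : {vspace vec}) P :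
  (P \in points_of U) = (vec_of P \in U).
Proof. by rewrite inE val_point -memvE. Qed.

(** * The polar form and its Gram matrix *)

Section Form.

Variable f : vec -> 'F_2.
Hypothesis f_quad : quadratic_form f.

Lemma form0 : f 0 = 0.
Proof. by case: f_quad => /(_ 0 0) + _; rewrite scale0r expr0n mul0r. Qed.

Lemma totally_isotropicP (U : {vspace vec}) :
  reflect (forall v, v \in U -> f v = 0) (totally_isotropic f U).
Proof.
apply: (iffP forallP) => [H v vU|H v].
  by apply/eqP; apply: (implyP (H v)).
by apply/implyP=> /H->.
Qed.

Lemma in_isotropic_points P : (P \in isotropic_points f) = (f (vec_of P) == 0).
Proof.
rewrite inE val_point; apply/totally_isotropicP/eqP => [->//|f0 v].
  exact: memv_line.
by rewrite memv_line_F2 => /orP[/eqP->|/eqP->]//; apply: form0.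
Qed.

Lemma polarC u v : polar f u v = polar f v u.
Proof. by rewrite /polar [v + u]addrC addrAC. Qed.

Lemma form_add u v : f (u + v) = f u + f v + polar f u v.
Proof. by rewrite /polar -[f (u + v) - _ - _]addrA -opprD [RHS]addrC subrK. Qed.

Definition polar_mx : 'M['F_2]_8 :=
  \matrix_(i, j) polar f (delta_mx 0 i) (delta_mx 0 j).

Lemma polar_sum_l (I : finType) (a : I -> 'F_2) (u : I -> vec) v :
  polar f (\sum_i a i *: u i) v = \sum_i a i * polar f (u i) v.
Proof.
have add0 : polar f 0 v = 0 by rewrite /polar form0 add0r subr0 subrr.
elim/big_rec2: _ => // i y x _ <-; exact: f_quad.2.
Qed.

Lemma polar_mxE u v : polar f u v = (u *m polar_mx *m v^T) 0 0.
Proof.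
rewrite {1}[u]row_sum_delta polar_sum_l -mulmxA mxE; apply: eq_bigr => i _.
congr (_ * _); rewrite polarC {1}[v]row_sum_delta polar_sum_l mxE.
by apply: eq_bigr => j _; rewrite !mxE polarC mulrC.
Qed.

Lemma polar_mx_sym : polar_mx^T = polar_mx.
Proof. by apply/matrixP => i j; rewrite !mxE polarC. Qed.


Definition perp_mx m (W : 'M['F_2]_(m, 8)) := kermx (polar_mx *m W^T).

Definition isotropic_mx m (W : 'M['F_2]_(m, 8)) :=
  forall v : vec, (v <= W)%MS -> f v = 0.

Lemma isotropic_sub_perp m (W : 'M['F_2]_(m, 8)) :
  isotropic_mx W -> (W <= perp_mx W)%MS.
Proof.
move=> isoW; apply/sub_kermxP/matrixP=> i j.
rewrite mulmxA mxE [RHS]mxE.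
transitivity (polar f (row i W) (row j W)).
  rewrite polar_mxE -row_mul [RHS]mxE; apply: eq_bigr => k _.
  rewrite [row _ _ _ _]mxE [(row _ _)^T _ _]mxE [row _ _ _ _]mxE.
  by rewrite [W^T _ _]mxE.
by rewrite /polar !isoW ?subrr ?addmx_sub ?row_sub.
Qed.

Lemma rank_perp_mx m (W : 'M['F_2]_(m, 8)) :
  \rank (perp_mx W) = (8 - \rank (W *m polar_mx))%N.
Proof. by rewrite mxrank_ker -mxrank_tr trmx_mul trmxK polar_mx_sym. Qed.

Hypothesis f_nondeg : nondegenerate_form f.

(** Nondegeneracy only excludes isotropic vectors from the radical. Hence [W] meets the radical in
    0, its complement [perp_mx f W] has rank 4 and so equals [W]; but the radical lies in that
    complement, so it is 0. *)
Lemma polar_mx_unit (W : 'M['F_2]_(4, 8)) :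
  row_free W -> isotropic_mx W -> polar_mx \in unitmx.
Proof.
move=> freeW isoW.
have W_ker : (W :&: kermx polar_mx)%MS = 0.
  apply/eqP; rewrite -submx0; apply/rV_subP => v.
  rewrite sub_capmx submx0 => /andP[/isoW f0 /sub_kermxP vM].
  by apply/eqP/f_nondeg => // w; rewrite polar_mxE vM mul0mx mxE.
have rankWM : \rank (W *m polar_mx) = 4%N.
  by have := mxrank_mul_ker W polar_mx; rewrite W_ker mxrank0 addn0 (eqP freeW).
have perpW : (perp_mx W <= W)%MS.
  have := mxrank_leqif_sup (isotropic_sub_perp isoW).
  by rewrite rank_perp_mx rankWM (eqP freeW) => -[_ <-].
rewrite -row_free_unit -kermx_eq0 -submx0 -W_ker sub_capmx submx_refl andbT.
by apply: submx_trans perpW; apply/sub_kermxP; rewrite mulmxA mulmx_ker mul0mx.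
Qed.

End Form.

(** Passing from subspaces to basis matrices makes the rank lemmas available. *)
Lemma vspace_row_base (U : {vspace vec}) n : \dim U = n ->
  exists2 B : 'M['F_2]_(n, 8),
    row_free B & forall v : vec, (v \in U) = (v <= B)%MS.
Proof.
move=> <-; pose B : 'M['F_2]_(\dim U, 8) := \matrix_i (vbasis U)`_i.
have memB v : (v \in U) = (v <= B)%MS.
  apply/idP/submxP => [vU|[a ->]].
    exists (\row_i coord (vbasis U) i v).
    rewrite mulmx_sum_row {1}(coord_vbasis vU).
    by apply: eq_bigr => i _; rewrite rowK mxE.
  rewrite mulmx_sum_row memv_suml // => i _; rewrite rowK memvZ //.
  by rewrite vbasis_mem // mem_nth ?size_tuple.
exists B => //; rewrite -kermx_eq0 -submx0; apply/row_subP => i.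
have /sub_kermxP := row_sub i (kermx B).
rewrite mulmx_sum_row => eq0; rewrite submx0; apply/eqP/rowP => j.
rewrite [RHS]mxE; have /freeP := basis_free (vbasisP U); apply.
by rewrite -[RHS]eq0; apply: eq_bigr => k _; rewrite rowK.
Qed.

(** * Dimension of the generators and hyperbolic coordinates *)

Section Generators.

Variable f : vec -> 'F_2.
Hypothesis f_quad : quadratic_form f.
Hypothesis f_nondeg : nondegenerate_form f.
Hypothesis f_hyp : hyperbolic_form f.

Local Notation M := (polar_mx f).

Lemma hyperbolic_row_base : exists2 W : 'M['F_2]_(4, 8),
  row_free W & isotropic_mx f W.
Proof.
have [U [/totally_isotropicP isoU dimU]] := f_hyp.
have [W freeW memW] := vspace_row_base dimU.
by exists W => // v; rewrite -memW; apply: isoU.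
Qed.

Lemma gram_unit : M \in unitmx.
Proof. by have [W] := hyperbolic_row_base; apply: polar_mx_unit. Qed.

Lemma perp_mx_rank n (B : 'M['F_2]_(n, 8)) :
  row_free B -> \rank (perp_mx f B) = (8 - n)%N.
Proof.
move=> /eqP rankB; rewrite rank_perp_mx ?mxrankMfree ?rankB //.
by rewrite row_free_unit gram_unit.
Qed.

Lemma totally_isotropic_add (U : {vspace vec}) (v : vec) :
    totally_isotropic f U -> f v = 0 ->
    (forall u, u \in U -> polar f u v = 0) ->
  totally_isotropic f (U + <[v]>).
Proof.
move=> /totally_isotropicP isoU fv polar0; apply/totally_isotropicP => w.
case/memv_addP=> u uU [t]; rewrite memv_line_F2 => tv ->.
rewrite form_add isoU // add0r.
case/orP: tv => /eqP->; last by rewrite fv polar0 // addr0.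
by rewrite /polar (form0 f_quad) addr0 subrr subr0 addr0.
Qed.

(** Upper bound: [U] lies in its orthogonal complement. Lower bound: for an isotropic [W] of rank 4,
    the part of [W] perpendicular to [U] lies in the part of [U] perpendicular to [W]. The pairing
    of [W] with [U] has the same rank from either side, so rank-nullity gives 4 <= dim U. *)
Lemma dim_generator U : max_totally_isotropic f U -> \dim U = 4%N.
Proof.
case/andP=> isoU /forallP maxU.
have [W freeW isoW] := hyperbolic_row_base.
have [B freeB memB] := vspace_row_base (erefl (\dim U)).
have isoB : isotropic_mx f B.
  by move=> v; rewrite -memB; apply/totally_isotropicP.
apply/eqP; rewrite eqn_leq; apply/andP; split.
  have := mxrankS (isotropic_sub_perp f_quad isoB).
  rewrite perp_mx_rank // (eqP freeB); case: (\dim U) => [|[|[|[|[|n]]]]] //.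
  by rewrite !subSS => /leq_trans/(_ (leq_subr _ _)).
(* An isotropic vector perpendicular to [U] extends it to a totally isotropic space, so by
   maximality it is already in [U]. *)
have WB : (W :&: perp_mx f B <= B :&: perp_mx f W)%MS.
  apply/rV_subP => v; rewrite (sub_capmx v W) => /andP[vW /sub_kermxP vB].
  rewrite sub_capmx (submx_trans vW (isotropic_sub_perp f_quad isoW)) andbT.
  rewrite -memB.
  have isoUv : totally_isotropic f (U + <[v]>).
    apply: totally_isotropic_add => //; first exact: isoW.
    move=> u; rewrite memB => /submxP[a ->].
    rewrite polarC polar_mxE // trmx_mul mulmxA -[v *m _ *m _]mulmxA vB mul0mx.
    by rewrite mxE.
  have /implyP := maxU (U + <[v]>)%VS.
  by rewrite isoUv addvSl => /(_ isT)/eqP <-; rewrite memvE addvSr.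
have rk : \rank (W *m (M *m B^T)) = \rank (B *m (M *m W^T)).
  by rewrite -mxrank_tr !trmx_mul trmxK polar_mx_sym mulmxA.
have rankW := mxrank_mul_ker W (M *m B^T); rewrite (eqP freeW) in rankW.
have rankB := mxrank_mul_ker B (M *m W^T); rewrite (eqP freeB) in rankB.
apply: leq_trans (eq_leq (esym rankW)) (leq_trans _ (eq_leq rankB)).
by rewrite rk leq_add2l mxrankS.
Qed.

(** [U2] is its own orthogonal complement and meets [U1] in 0, so the Gram matrix [N] between bases
    of the two is invertible. Replacing the basis of [U2] by the dual one turns the form into the
    dot product. *)
Lemma hyperbolic_coordinates (U1 U2 : {vspace vec}) :
    max_totally_isotropic f U1 -> max_totally_isotropic f U2 ->
    (U1 :&: U2 = 0)%VS ->
  exists E : 'M['F_2]_(4 + 4, 8),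
    [/\ E \in unitmx,
        forall a b : 'rV_4, f (row_mx a b *m E) = (a *m b^T) 0 0,
        forall a b : 'rV_4, (row_mx a b *m E \in U1) = (b == 0)
      & forall a b : 'rV_4, (row_mx a b *m E \in U2) = (a == 0)].
Proof.
move=> max1 max2 cap0.
have [E1 free1 mem1] := vspace_row_base (dim_generator max1).
have [D freeD memD] := vspace_row_base (dim_generator max2).
have iso1 : isotropic_mx f E1.
  by move=> v; rewrite -mem1; apply/totally_isotropicP; case/andP: max1.
have isoD : isotropic_mx f D.
  by move=> v; rewrite -memD; apply/totally_isotropicP; case/andP: max2.
have capD : (E1 :&: D)%MS = 0.
  apply/eqP; rewrite -submx0; apply/rV_subP => v.
  by rewrite sub_capmx -mem1 -memD -memv_cap cap0 memv0 submx0.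
have perpD : (perp_mx f D <= D)%MS.
  have := mxrank_leqif_sup (isotropic_sub_perp f_quad isoD).
  by rewrite perp_mx_rank // (eqP freeD) => -[_ <-].
pose N := E1 *m M *m D^T.
have unitN : N \in unitmx.
  have := mxrank_mul_ker E1 (M *m D^T).
  have /eqP -> : (E1 :&: perp_mx f D)%MS == 0 by rewrite -submx0 -capD capmxS.
  by rewrite -row_free_unit /row_free mxrank0 addn0 (eqP free1) mulmxA => ->.
(* The inverse transpose is chosen so that the Gram matrix of [E1] against [E2] becomes N N^-1 =
   1. *)
pose E2 := (invmx N)^T *m D.
have unitN' : (invmx N)^T \in unitmx by rewrite unitmx_tr unitmx_inv.
have eqD : (E2 :=: D)%MS by apply: eqmxMfull; rewrite row_full_unit.
have free2 : row_free E2 by rewrite /row_free eqD.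
have cap12 : (E1 :&: E2)%MS = 0.
  by apply/eqP; rewrite -submx0 -capD capmxS // eqD.
have gram1 : E1 *m M *m E2^T = 1%:M.
  by rewrite /E2 trmx_mul trmxK (mulmxA (E1 *m M)) (mulmxV unitN).
exists (col_mx E1 E2); split=> [|a b|a b|a b].
- rewrite -row_full_unit /row_full -addsmxE.
  have := mxrank_sum_cap E1 E2.
  by rewrite cap12 mxrank0 addn0 (eqP free1) (eqP free2) => ->.
- rewrite mul_row_col form_add iso1 ?submxMl // isoD ?add0r; last first.
    by rewrite -eqD submxMl.
  rewrite polar_mxE // trmx_mul -[a *m E1 *m M]mulmxA.
  rewrite [_ *m (E2^T *m _)]mulmxA.
  by rewrite -[a *m (E1 *m M) *m E2^T]mulmxA gram1 mulmx1.
- rewrite mul_row_col rpredDl ?mem1 ?submxMl //.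
  apply/idP/eqP => [le_bE|->]; last by rewrite mul0mx sub0mx.
  apply: (row_free_inj free2); rewrite /= mul0mx.
  by apply/eqP; rewrite -submx0 -cap12 sub_capmx le_bE submxMl.
- rewrite mul_row_col rpredDr ?memD -?eqD ?submxMl //.
  apply/idP/eqP => [le_aE|->]; last by rewrite mul0mx sub0mx.
  apply: (row_free_inj free1); rewrite /= mul0mx.
  by apply/eqP; rewrite -submx0 -cap12 sub_capmx le_aE submxMl.
Qed.

End Generators.

(** * Coordinates and collineations *)

Definition row_of_bits (x : bits4) : 'rV['F_2]_4 :=
  let: (x1, x2, x3, x4) := x in
  \row_j nth 0 [:: x1%:R; x2%:R; x3%:R; x4%:R] j.

Definition bits_of_row (r : 'rV['F_2]_4) : bits4 :=
  (r 0 (inord 0) == 1, r 0 (inord 1) == 1, r 0 (inord 2) == 1,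
   r 0 (inord 3) == 1).

Arguments row_of_bits : simpl never.
Arguments bits_of_row : simpl never.

Lemma F2_eq1 (b : bool) : (b%:R == 1 :> 'F_2) = b.
Proof. by case: b. Qed.

Lemma F2_addb (b c : bool) : (b (+) c)%:R = b%:R + c%:R :> 'F_2.
Proof. by apply: val_inj; case: b c => [] []. Qed.

Lemma F2_nat_eq1 (a : 'F_2) : (a == 1)%:R = a.
Proof. by case: (F2_cases a) => ->; apply: val_inj. Qed.

Lemma row_of_bitsK : cancel row_of_bits bits_of_row.
Proof.
case=> [[[x1 x2] x3] x4]; rewrite /bits_of_row /row_of_bits !mxE !inordK //=.
by rewrite !F2_eq1.
Qed.

Lemma bits_of_rowK : cancel bits_of_row row_of_bits.
Proof.
move=> r; apply/rowP => j; rewrite mxE !F2_nat_eq1.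
by case: j => [[|[|[|[|j]]]] lt_j] //=; congr (r _ _); apply: val_inj;
  rewrite /= inordK.
Qed.

Lemma row_of_bitsD x y : row_of_bits (add4 x y) = row_of_bits x + row_of_bits y.
Proof.
case: x y => [[[x1 x2] x3] x4] [[[y1 y2] y3] y4]; apply/rowP => j; rewrite !mxE.
by case: j => [[|[|[|[|j]]]] lt_j] //=; rewrite F2_addb.
Qed.

Lemma row_of_bits_eq0 x : (row_of_bits x == 0) = (x == zero4).
Proof.
have <- : row_of_bits zero4 = 0.
  by apply/rowP=> j; rewrite !mxE; case: j => [[|[|[|[|j]]]] lt_j] //=.
exact: (inj_eq (can_inj row_of_bitsK)).
Qed.

Lemma row_of_bits_dot x y :
  (row_of_bits x *m (row_of_bits y)^T) 0 0 = (dot4 x y)%:R.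
Proof.
case: x y => [[[x1 x2] x3] x4] [[[y1 y2] y3] y4].
rewrite mxE !big_ord_recl big_ord0 !mxE /= addr0 !F2_addb -!natrM !mulnb.
by rewrite !addrA.
Qed.

(** Moves the coordinates to bit tuples, on which the exhaustive checks were run. *)
Lemma hyperbolic_bit_coordinates (f : vec -> 'F_2) (U1 U2 : {vspace vec}) :
    quadratic_form f -> nondegenerate_form f -> hyperbolic_form f ->
    max_totally_isotropic f U1 -> max_totally_isotropic f U2 ->
    (U1 :&: U2 = 0)%VS ->
  exists enc : bits8 -> vec,
    [/\ bijective enc,
        {morph enc : u v / add8 u v >-> u + v},
        forall u, f (enc u) = (dot4 u.1 u.2)%:R,
        forall u, (enc u \in U1) = (u.2 == zero4)
      & forall u, (enc u \in U2) = (u.1 == zero4)].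
Proof.
move=> f_quad f_nondeg f_hyp max1 max2 cap0.
have [E [E_unit fE memE1 memE2]] :=
  hyperbolic_coordinates f_quad f_nondeg f_hyp max1 max2 cap0.
exists (fun u => row_mx (row_of_bits u.1) (row_of_bits u.2) *m E).
split=> [|u v|u|u|u].
- pose dec v := let w := v *m invmx E in
    (bits_of_row (lsubmx w), bits_of_row (rsubmx w)).
  exists dec => [[x y]|v]; rewrite /dec /=.
    by rewrite mulmxK // row_mxKl row_mxKr !row_of_bitsK.
  by rewrite !bits_of_rowK hsubmxK mulmxKV.
- by rewrite /add8 /= !row_of_bitsD -add_row_mx mulmxDl.
- by rewrite fE row_of_bits_dot.
- by rewrite memE1 row_of_bits_eq0.
- by rewrite memE2 row_of_bits_eq0.
Qed.

Section Collineations.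

Variable f : vec -> 'F_2.

(** The only scalars are 0 and 1, so additivity is linearity. *)
Lemma additive_mulmx (phi : vec -> vec) :
  {morph phi : u v / u + v} -> exists A : 'M['F_2]_8, forall v, v *m A = phi v.
Proof.
move=> phiD.
have phi0 : phi 0 = 0.
  by apply: (addIr (phi 0)); rewrite -phiD !add0r.
have phiZ a v : phi (a *: v) = a *: phi v.
  by case: (F2_cases a) => ->; rewrite ?scale0r ?scale1r.
exists (\matrix_i phi (delta_mx 0 i)) => v.
rewrite mulmx_sum_row [in RHS](row_sum_delta v) (big_morph phi phiD phi0).
by apply: eq_bigr => i _; rewrite rowK phiZ.
Qed.

Lemma induces_vec (A : 'M['F_2]_8) (g : {perm point}) :
  reflect (forall P, vec_of (g P) = vec_of P *m A)
          (induces A g).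
Proof.
have imA P : (linfun (mulmxr A) @: val P)%VS = <[vec_of P *m A]>%VS.
  by rewrite val_point limg_line lfunE.
apply: (iffP forallP) => [indA P|vecA P]; last by rewrite imA -vecA -val_point.
have /eqP := indA P; rewrite imA => eq_val.
have : vec_of (g P) \in <[vec_of P *m A]>%VS by rewrite -eq_val memv_pick.
by rewrite memv_line_F2 (negPf (vec_of_neq0 _)) => /eqP.
Qed.

(** The only nonzero scalar is 1, so preserving [f] up to a scalar is preserving it. *)
Lemma PGO_P (g : {perm point}) :
  reflect (exists A : 'M['F_2]_8,
             [/\ A \in unitmx, forall v : vec, f (v *m A) = f v
               & forall P, vec_of (g P) = vec_of P *m A])
          (g \in PGO f).
Proof.
rewrite inE; apply: (iffP existsP) => [[A /and3P[uA fA indA]]|[A [uA fA vecA]]].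
  exists A; split=> //; last exact/induces_vec.
  case/existsP: fA => c /andP[c_neq0 /forallP fA] v.
  rewrite (eqP (fA v)).
  case: (F2_cases c) => c_val; last by rewrite c_val mul1r.
  by rewrite c_val eqxx in c_neq0.
exists A; apply/and3P; split=> //; last exact/induces_vec.
apply/existsP; exists 1; rewrite oner_neq0; apply/forallP => v.
by rewrite mul1r fA.
Qed.

Lemma PGO_group : group_set (PGO f).
Proof.
apply/group_setP; split=> [|g h /PGO_P[A [uA fA vecA]] /PGO_P[B [uB fB vecB]]].
  apply/PGO_P; exists 1%:M; split=> [|v|P]; rewrite ?unitmx1 ?mulmx1 //.
  by rewrite perm1.
apply/PGO_P; exists (A *m B); split=> [|v|P].
- by rewrite unitmx_mul uA.
- by rewrite mulmxA fB fA.
- by rewrite permM vecB vecA mulmxA.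
Qed.

Lemma PGO_involution (phi : vec -> vec) :
    {morph phi : u v / u + v} -> involutive phi ->
    (forall v, f (phi v) = f v) ->
  exists2 g : {perm point}, g \in PGO f
    & forall P, vec_of (g P) = phi (vec_of P).
Proof.
move=> phiD phiK f_phi; have [A phiA] := additive_mulmx phiD.
have phi_neq0 P : phi (vec_of P) != 0.
  apply: contraNneq (vec_of_neq0 P) => phi_v0.
  by rewrite -[vec_of P]phiK phi_v0 -phiA mul0mx.
have vec_phi P : vec_of (point_of (phi (vec_of P))) = phi (vec_of P).
  exact: point_ofK.
have g_inj : injective (fun P => point_of (phi (vec_of P))).
  move=> P Q /(congr1 vec_of); rewrite !vec_phi.
  by move=> /(inv_inj phiK)/vec_of_inj.
have vec_g P : vec_of (perm g_inj P) = phi (vec_of P) by rewrite permE vec_phi.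
exists (perm g_inj) => //; apply/PGO_P; exists A.
split=> [|v|P]; rewrite ?phiA //.
(* The matrix of an involution is its own inverse, hence invertible. *)
have AA : A *m A = 1%:M.
  apply/row_matrixP => i.
  by rewrite row_mul !rowE -mulmxA mulmxA !phiA phiK mulmx1.
by have [] := mulmx1_unit AA.
Qed.

Definition preserves_family (F : {set {set point}}) (g : {perm point}) :=
  forall T, T \in F -> [set g Q | Q in T] \in F.

Lemma GstarP (S : {set {set point}}) (S1 S2 : {set point}) g :
  reflect [/\ g \in PGO f, preserves_family [set S1; S2] g
            & preserves_family (S :\: [set S1; S2]) g]
          (g \in Gstar f S S1 S2).
Proof.
have memN F : reflect (preserves_family F g) (g \in 'N(F | 'P^*)%g).
  rewrite inE in_setT inE; apply: (iffP subsetP) => H T TF.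
    by have := H T TF; rewrite inE.
  by rewrite inE; apply: H.
apply: (iffP setIP) => [[/setIP[gP N1] /setIP[_ N2]]|[gP N1 N2]].
  by split=> //; apply/memN.
by split; apply/setIP; split=> //; apply/memN.
Qed.

Lemma Gstar_group S S1 S2 : group_set (Gstar f S S1 S2).
Proof.
exact: (groupP ('N_(Group PGO_group)([set S1; S2] | 'P^*)
  :&: 'N_(Group PGO_group)(S :\: [set S1; S2] | 'P^*))%G).
Qed.

End Collineations.

(** * The spread and its stabiliser *)

Section Spread.

Variable f : vec -> 'F_2.
Hypothesis f_quad : quadratic_form f.
Hypothesis f_nondeg : nondegenerate_form f.
Hypothesis f_hyp : hyperbolic_form f.
Variable S : {set {set point}}.
Hypothesis S_spread : is_spread f S.

Lemma spread_generator T : T \in S ->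
  exists2 U, max_totally_isotropic f U & T = points_of U.
Proof.
case/andP: S_spread => /subsetP genS _ /genS/imsetP[U].
by rewrite inE => maxU ->; exists U.
Qed.

Lemma spread_disjoint T1 T2 P :
  T1 \in S -> T2 \in S -> P \in T1 -> P \in T2 -> T1 = T2.
Proof.
case/andP: S_spread => _ /and3P[_ trivS _] T1S T2S PT1 PT2.
by rewrite -(def_pblock trivS T1S PT1) (def_pblock trivS T2S PT2).
Qed.

Lemma spread_capv U1 U2 :
    points_of U1 \in S -> points_of U2 \in S -> points_of U1 <> points_of U2 ->
  (U1 :&: U2 = 0)%VS.
Proof.
move=> U1S U2S neq12; apply/eqP; rewrite -subv0; apply/subvP => v.
rewrite memv_cap memv0 => /andP[v1 v2]; apply/negPn/negP => v_neq0.
by apply: neq12; apply: (@spread_disjoint _ _ (point_of v));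
  rewrite ?in_points_of ?point_ofK.
Qed.

Lemma spread_cover P : f (vec_of P) = 0 -> exists2 T, T \in S & P \in T.
Proof.
move=> fP; case/andP: S_spread => _ /and3P[/eqP coverS _ _].
have : P \in cover S by rewrite coverS in_isotropic_points // fP.
by case/bigcupP=> T TS PT; exists T.
Qed.

Variables U1 U2 : {vspace vec}.
Let S1 := points_of U1.
Let S2 := points_of U2.
Hypothesis S1_in : S1 \in S.
Hypothesis S2_in : S2 \in S.
Hypothesis U12 : (U1 :&: U2 = 0)%VS.
Hypothesis dimU2 : \dim U2 = 4%N.

Variables (enc : bits8 -> vec) (dec : vec -> bits8).
Hypothesis encK : cancel enc dec.
Hypothesis decK : cancel dec enc.
Hypothesis encD : {morph enc : u v / add8 u v >-> u + v}.
Hypothesis f_enc : forall u, f (enc u) = (dot4 u.1 u.2)%:R.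
Hypothesis enc1 : forall u, (enc u \in U1) = (u.2 == zero4).
Hypothesis enc2 : forall u, (enc u \in U2) = (u.1 == zero4).

Local Notation decp P := (dec (vec_of P)).

Lemma decp_S1 P : (P \in S1) = ((decp P).2 == zero4).
Proof. by rewrite in_points_of -{1}[vec_of P]decK enc1. Qed.

Lemma decp_S2 P : (P \in S2) = ((decp P).1 == zero4).
Proof. by rewrite in_points_of -{1}[vec_of P]decK enc2. Qed.

Lemma enc_eq0 u : (enc u == 0) = (u == (zero4, zero4)).
Proof.
have <- : enc (zero4, zero4) = 0.
  by apply: (addIr (enc (zero4, zero4))); rewrite -encD add0r.
exact: (inj_eq (can_inj encK)).
Qed.

Lemma decp_point u : u != (zero4, zero4) -> decp (point_of (enc u)) = u.
Proof. by move=> u_neq0; rewrite point_ofK ?encK // enc_eq0. Qed.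

Lemma decp_inj P Q : decp P = decp Q -> P = Q.
Proof. by move/(can_inj decK)/vec_of_inj. Qed.

(** * Spread members as graphs of alternating matrices *)

Definition graph (a : alt4) : {set point} :=
  [set P | (decp P).2 == alt_act a (decp P).1].

(** [U] is a complement of [U2], so it is the graph of a linear map x |-> y; vanishing of the form
    on [U] makes that map alternating. *)
Lemma spread_member_graph T :
  T \in S -> T != S1 -> T != S2 -> exists a, T = graph a.
Proof.
move=> TS T1 T2; have [U maxU defT] := spread_generator TS.
have UU1 : (U :&: U1 = 0)%VS.
  by apply: spread_capv => //; rewrite -?defT //; apply/eqP.
have UU2 : (U :&: U2 = 0)%VS.
  by apply: spread_capv => //; rewrite -?defT //; apply/eqP.
have isoU u : enc u \in U -> dot4 u.1 u.2 = false.
  case/andP: maxU => /totally_isotropicP isoU _ /isoU.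
  by rewrite f_enc; case: (dot4 _ _).
(* The dimensions 4 + 4 fill the space; (x, 0) is projected to [U] along [U2]. *)
have memU x : exists y, enc (x, y) \in U.
  have : enc (x, zero4) \in (U + U2)%VS.
    suff -> : (U + U2)%VS = fullv by rewrite memvf.
    apply/eqP; rewrite eqEdim subvf -[(_ <= _)%N]/(_ <= _)%N.
    have := dimv_sum_cap U U2; rewrite UU2 dimv0 addn0 => ->.
    by rewrite dimvf (dim_generator f_quad f_nondeg f_hyp maxU) dimU2.
  case/memv_addP => u uU [w wU2 def_x]; exists (dec w).2.
  have -> : (x, (dec w).2) = add8 (x, zero4) (dec w).
    move: wU2; rewrite -{1}[w]decK enc2 => /eqP w1.
    by rewrite /add8 /= w1 add4_0 add0_4.
  by rewrite encD decK def_x -addrA addF2_self addr0.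
have graphU (a : alt4) : (forall x, enc (x, alt_act a x) \in U) ->
    T = graph a.
  move=> aU; apply/setP=> P; rewrite defT in_points_of inE.
  case def_P: (decp P) => [x y] /=.
  have -> : vec_of P = enc (x, y) by rewrite -def_P decK.
  apply/idP/eqP => [xyU|-> //]; apply/eqP.
  have : enc (zero4, add4 y (alt_act a x)) \in (U :&: U2)%VS.
    rewrite memv_cap enc2 eqxx andbT.
    have -> : (zero4, add4 y (alt_act a x)) = add8 (x, y) (x, alt_act a x).
      by congr (_, _); apply/esym/eqP; rewrite add4_eq0.
    by rewrite encD memvD.
  by rewrite UU2 memv0 enc_eq0 xpair_eqE eqxx add4_eq0.
have [[[[y11 y12] y13] y14] U_1] := memU (true, false, false, false).
have [[[[y21 y22] y23] y24] U_2] := memU (false, true, false, false).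
have [[[[y31 y32] y33] y34] U_3] := memU (false, false, true, false).
have [[[[y41 y42] y43] y44] U_4] := memU (false, false, false, true).
have isoD u v : enc u \in U -> enc v \in U ->
    dot4 (add4 u.1 v.1) (add4 u.2 v.2) = false.
  by move=> uU vU; apply: (isoU (add8 u v)); rewrite encD memvD.
(* Isotropy over the four unit vectors kills the diagonal; isotropy of their pairwise sums then
   gives symmetry. *)
move: (isoU _ U_1) (isoU _ U_2) (isoU _ U_3) (isoU _ U_4).
move: (isoD _ _ U_1 U_2) (isoD _ _ U_1 U_3) (isoD _ _ U_1 U_4).
move: (isoD _ _ U_2 U_3) (isoD _ _ U_2 U_4) (isoD _ _ U_3 U_4).
rewrite /dot4 /add4 /= !addbF => + + + + + + y11_0 y22_0 y33_0 y44_0.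
subst y11 y22 y33 y44; rewrite !addbF !addFb.
have eq_addb (p q : bool) : p (+) q = false -> p = q by case: p q => [] [].
do 6![move/eq_addb=> ?]; subst y21 y31 y41 y32 y42 y43.
exists (y12, y13, y14, y23, y24, y34); apply: graphU.
apply: bits4_ind => [x y xU yU||||];
  try by rewrite /alt_act !andbT !andbF !addbF ?addFb.
by rewrite alt_actDr; have := memvD xU yU; rewrite -encD.
Qed.

Lemma graph_inj : injective graph.
Proof.
move=> a b eq_ab; apply: alt_act_inj => x.
have [x0|x_neq0] := eqVneq x zero4; first by rewrite x0 !alt_act0.
have : point_of (enc (x, alt_act a x)) \in graph a.
  by rewrite inE decp_point ?xpair_eqE ?(negPf x_neq0).
by rewrite eq_ab inE decp_point ?xpair_eqE ?(negPf x_neq0) // => /eqP.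
Qed.

(** A kernel vector x would put the point (x, 0) on both the graph and [S1]. *)
Lemma graph_pfaffian a : graph a \in S -> graph a != S1 -> pfaffian a.
Proof.
move=> aS; apply: contraNT => /pfaffian_kernel[x x_neq0 ax0].
have decx : decp (point_of (enc (x, zero4))) = (x, zero4).
  by rewrite decp_point // xpair_eqE (negPf x_neq0).
apply/eqP; apply: (@spread_disjoint _ _ (point_of (enc (x, zero4)))) => //.
  by rewrite inE decx ax0.
by rewrite decp_S1 decx.
Qed.

(** A kernel vector x of a + b would put the point (x, a x) on both graphs. *)
Lemma graph_adj a b :
  graph a \in S -> graph b \in S -> a != b -> alt_adj a b.
Proof.
move=> aS bS; apply: contraNT => /pfaffian_kernel[x x_neq0 /alt_add_eq_act abx].
pose u := (x, alt_act a x).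
have decu : decp (point_of (enc u)) = u.
  by rewrite decp_point // xpair_eqE (negPf x_neq0).
apply/eqP/graph_inj/(@spread_disjoint _ _ (point_of (enc u))) => //.
  by rewrite inE decu.
by rewrite inE decu -abx.
Qed.

(** Together with the zero matrix, whose graph is [S1], this is a Kerdock set. Filtering [alt_units]
    makes it a subsequence, as [kerdock_set_good] requires. *)
Definition kerdock_set : seq alt4 :=
  filter (fun a => graph a \in S :\: [set S1; S2]) alt_units.

Local Notation K := kerdock_set.

Lemma mem_kerdock_set a : (a \in K) = (graph a \in S :\: [set S1; S2]).
Proof.
rewrite mem_filter mem_alt_units andb_idr // !inE negb_or.
by case/andP=> /andP[a1 _] aS; apply: graph_pfaffian.
Qed.

Lemma kerdock_set_S a : a \in K -> graph a \in S.
Proof. by rewrite mem_kerdock_set inE => /andP[]. Qed.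

Lemma kerdock_set_pfaffian a : a \in K -> pfaffian a.
Proof. by rewrite mem_filter mem_alt_units => /andP[]. Qed.

Lemma kerdock_setP T :
  T \in S :\: [set S1; S2] -> exists2 a, a \in K & T = graph a.
Proof.
move=> TS; have := TS; rewrite !inE negb_or => /andP[/andP[T1 T2] TS'].
have [a defT] := spread_member_graph TS' T1 T2.
by exists a => //; rewrite mem_kerdock_set -defT.
Qed.

Lemma kerdock_set_cover x y : x != zero4 -> y != zero4 -> ~~ dot4 x y ->
  exists2 a, a \in K & alt_act a x = y.
Proof.
move=> x_neq0 y_neq0 /negPf xy0; pose P := point_of (enc (x, y)).
have decP : decp P = (x, y) by rewrite decp_point // xpair_eqE (negPf x_neq0).
have [|T TS PT] := @spread_cover P.
  by rewrite -[vec_of P]decK decP f_enc xy0.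
have [|a aK defT] := @kerdock_setP T.
  rewrite !inE TS andbT negb_or; apply/andP; split.
    by apply: contraTneq PT => ->; rewrite decp_S1 decP.
  by apply: contraTneq PT => ->; rewrite decp_S2 decP.
by exists a => //; move: PT; rewrite defT inE decP => /eqP.
Qed.

(** For a fixed nonzero e, each of the seven nonzero y perpendicular to e is a e for some member
    a. *)
Lemma kerdock_set_size : (7 <= size K)%N.
Proof.
pose e : bits4 := (true, false, false, false).
pose s := filter (fun y => (y != zero4) && ~~ dot4 e y) all4.
have -> : 7%N = size s by vm_compute.
rewrite -(size_map (alt_act^~ e) K); apply: uniq_leq_size; first by vm_compute.
move=> y; rewrite mem_filter => /andP[/andP[y_neq0 ey0] _].
have [//|a aK <-] := @kerdock_set_cover e y _ y_neq0 ey0.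
exact: map_f.
Qed.

Lemma kerdock_set_uniq : uniq K.
Proof. by apply/filter_uniq; vm_compute. Qed.

Lemma kerdock_set_closed : reflect_closed K /\ two_step_transitive K.
Proof.
apply: (kerdock_set_good (filter_subseq _ _)); last exact: kerdock_set_size.
apply: pairwise_uniq_in kerdock_set_uniq _ => a b aK bK.
by apply: graph_adj; apply: kerdock_set_S.
Qed.

Lemma pair_sums_pfaffian m : m \in pair_sums K -> pfaffian m.
Proof.
case/(pair_sumsP kerdock_set_uniq)=> a [b [aK bK neq_ab ->]].
by apply: graph_adj; rewrite ?kerdock_set_S.
Qed.

Lemma swap_collineation m : m \in pair_sums K ->
  exists2 g : {perm point}, g \in Gstar f S S1 S2
    & forall P, decp (g P) = swap m (decp P).
Proof.
move=> mM; have pf_m := pair_sums_pfaffian mM.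
have [|v|v|g gP vec_g] := @PGO_involution f (fun v => enc (swap m (dec v))).
- move=> u v /=; rewrite -encD -swapD; congr (enc (swap m _)).
  by apply: (can_inj encK); rewrite decK encD !decK.
- by rewrite encK swapK ?decK.
- by rewrite f_enc dot4_swap // -f_enc decK.
have decg P : decp (g P) = swap m (decp P) by rewrite vec_g encK.
have gK : involutive g.
  by move=> P; apply: decp_inj; rewrite decg decg (swapK pf_m).
(* As [g] is an involution, mapping [A] into [B] and [B] into [A] already gives equality. *)
have im_g (A B : {set point}) :
    (forall P, P \in A -> g P \in B) -> (forall P, P \in B -> g P \in A) ->
    [set g Q | Q in A] = B.
  move=> AB BA; apply/setP=> P.
  apply/imsetP/idP => [[Q QA ->]|PB]; first exact: AB.
  by exists (g P); rewrite ?gK ?BA.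
have g1 : [set g Q | Q in S1] = S2.
  apply: im_g => P; rewrite decp_S1 decp_S2 decg /= => /eqP->;
    by rewrite alt_act0.
have g2 : [set g Q | Q in S2] = S1.
  apply: im_g => P; rewrite decp_S1 decp_S2 decg /= => /eqP->;
    by rewrite alt_act0.
exists g => //; apply/GstarP; split=> // T.
  by rewrite !inE => /orP[]/eqP->; rewrite ?g1 ?g2 eqxx ?orbT.
case/kerdock_setP=> c cK ->.
have pf_c := kerdock_set_pfaffian cK.
have rcK : alt_reflect m c \in K.
  by have [/allP/(_ m mM)/allP/(_ c cK)] := kerdock_set_closed.
have img c' : pfaffian c' ->
    forall P, P \in graph c' -> g P \in graph (alt_reflect m c').
  move=> pf_c' P; rewrite !inE decg /= => /eqP->.
  by have [_ _ ->] := alt_reflectP pf_m pf_c'.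
have [pf_rc rK _] := alt_reflectP pf_m pf_c.
suff -> : [set g Q | Q in graph c] = graph (alt_reflect m c).
  by rewrite -mem_kerdock_set.
by apply: im_g; [exact: img | rewrite -{2}rK; exact: img].
Qed.

Canonical Gstar_Group := Group (Gstar_group f S S1 S2).

Lemma in_anisotropic_points P :
  (P \in anisotropic_points f) = dot4 (decp P).1 (decp P).2.
Proof.
rewrite inE in_isotropic_points // -{1}[vec_of P]decK f_enc.
by case: (dot4 _ _).
Qed.

Lemma mem_nonperp u : (u \in nonperp) = dot4 u.1 u.2.
Proof.
rewrite mem_filter andb_idr // => _; case: u => x y.
by rewrite allpairs_f ?mem_all4.
Qed.

(** Every anisotropic point is reached from [base8] by two swaps, and these lie in the group. *)
Lemma Gstar_transitive P Q :
    P \in anisotropic_points f -> Q \in anisotropic_points f ->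
  exists2 g, g \in Gstar f S S1 S2 & g P = Q.
Proof.
rewrite !in_anisotropic_points => anisoP anisoQ.
have from_base R : dot4 (decp R).1 (decp R).2 ->
    exists2 g, g \in Gstar f S S1 S2 & g (point_of (enc base8)) = R.
  have [_ /allP reached] := kerdock_set_closed.
  rewrite -mem_nonperp => /reached/allpairsP[[m u] /= [mM]].
  case/mapP=> m' m'M -> def_R.
  have [g gG decg] := swap_collineation mM.
  have [g' g'G decg'] := swap_collineation m'M.
  exists (g' * g)%g; first exact: groupM.
  by apply: decp_inj; rewrite permM decg decg' decp_point.
have [g gG gP] := from_base P anisoP; have [h hG hQ] := from_base Q anisoQ.
exists (g^-1 * h)%g; first by rewrite groupM ?groupV.
by rewrite permM -gP permK.
Qed.

(** This bound later forces an injection into the 120 members of [Y] to be onto. *)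
Lemma card_anisotropic_points : (120 <= #|anisotropic_points f|)%N.
Proof.
have -> : 120%N = size [seq point_of (enc u) | u <- nonperp].
  by rewrite size_map; vm_compute.
have dec_nonperp u : u \in nonperp -> decp (point_of (enc u)) = u.
  move=> uN; rewrite decp_point //; apply: contraTneq uN => ->.
  by vm_compute.
rewrite cardE; apply: uniq_leq_size => [|P /mapP[u uN ->]].
  rewrite map_inj_in_uniq => [|u v uN vN /(congr1 (fun P => decp P))].
    by vm_compute.
  by rewrite !dec_nonperp.
by rewrite mem_enum in_anisotropic_points dec_nonperp // -mem_nonperp.
Qed.


(** * The line through an anisotropic point that meets both chosen spread members *)

Definition foot1 (P : point) : point := point_of (enc ((decp P).1, zero4)).
Definition foot2 (P : point) : point := point_of (enc (zero4, (decp P).2)).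
(** For anisotropic (x, y) we have <x, y> = 1, so x and y are nonzero and neither foot is the
    default value of [point_of]. *)
Definition feet (P : point) : {set point} := [set foot1 P; foot2 P].
Definition transversal (P : point) : {set point} :=
  points_of (<[vec_of (foot1 P)]> + <[vec_of (foot2 P)]>).

Lemma feet_unique P Q1 Q2 :
    Q1 \in S1 -> Q2 \in S2 -> vec_of P = vec_of Q1 + vec_of Q2 ->
  foot1 P = Q1 /\ foot2 P = Q2.
Proof.
rewrite decp_S1 decp_S2 => /eqP Q1_2 /eqP Q2_1 def_P.
have def_Q1 : enc ((decp Q1).1, zero4) = vec_of Q1.
  by rewrite -Q1_2 -surjective_pairing decK.
have def_Q2 : enc (zero4, (decp Q2).2) = vec_of Q2.
  by rewrite -Q2_1 -surjective_pairing decK.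
rewrite /foot1 /foot2 def_P -def_Q1 -def_Q2 -encD encK /= add4_0 add0_4.
by rewrite def_Q1 def_Q2 !vec_ofK.
Qed.

Section Transversal.

Variable P : point.
Hypothesis anisoP : P \in anisotropic_points f.

Lemma decp_foot1 : decp (foot1 P) = ((decp P).1, zero4).
Proof.
rewrite decp_point // xpair_eqE negb_and; apply/orP; left.
move: anisoP; rewrite in_anisotropic_points; apply: contraTneq => ->.
by case: (_.2) => [[[]]].
Qed.

Lemma decp_foot2 : decp (foot2 P) = (zero4, (decp P).2).
Proof.
rewrite decp_point // xpair_eqE negb_and; apply/orP; right.
move: anisoP; rewrite in_anisotropic_points; apply: contraTneq => ->.
by case: (_.1) => [[[a1 a2] a3] a4]; rewrite /dot4 /= !andbF.
Qed.

Lemma vec_of_feet : vec_of P = vec_of (foot1 P) + vec_of (foot2 P).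
Proof.
apply: (can_inj decK); rewrite -[vec_of (foot1 P)]decK -[vec_of (foot2 P)]decK.
rewrite decp_foot1 decp_foot2 -encD encK /add8 /= add4_0 add0_4.
by case: (decp P).
Qed.

Lemma foot1_S1 : foot1 P \in S1.
Proof. by rewrite decp_S1 decp_foot1. Qed.

Lemma foot2_S2 : foot2 P \in S2.
Proof. by rewrite decp_S2 decp_foot2. Qed.

Lemma aniso_notin_S1 : P \notin S1.
Proof.
apply: contraTN anisoP; rewrite in_anisotropic_points decp_S1 => /eqP->.
by case: (_.1) => [[[a1 a2] a3] a4]; rewrite /dot4 /= !andbF.
Qed.

Lemma aniso_notin_S2 : P \notin S2.
Proof.
apply: contraTN anisoP; rewrite in_anisotropic_points decp_S2 => /eqP->.
by case: (_.2) => [[[]]].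
Qed.

Lemma disjoint_S1_S2 Q : Q \in S1 -> Q \notin S2.
Proof.
rewrite decp_S1 decp_S2 => /eqP Q2; apply/negP => /eqP Q1.
have := vec_of_neq0 Q; rewrite -[vec_of Q]decK enc_eq0.
by rewrite [decp Q]surjective_pairing Q1 Q2 eqxx.
Qed.

(** A line over the field with two elements has three points, the third being the sum of the other
    two. *)
Lemma in_transversal Q :
  (Q \in transversal P) = [|| Q == foot1 P, Q == foot2 P | Q == P].
Proof.
rewrite in_points_of; apply/memv_addP/or3P => [[u uF [v vF def_Q]]|].
  move: uF vF def_Q (vec_of_neq0 Q); rewrite !memv_line_F2.
  case/orP=> /eqP-> /orP[]/eqP->; rewrite ?add0r ?addr0 -?vec_of_feet.
  - by move=> ->; rewrite eqxx.
  - by move=> /vec_of_inj-> _; constructor 2.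
  - by move=> /vec_of_inj-> _; constructor 1.
  - by move=> /vec_of_inj-> _; constructor 3.
case=> /eqP->.
- exists (vec_of (foot1 P)); rewrite ?memv_line //.
  by exists 0; rewrite ?mem0v ?addr0.
- exists 0; rewrite ?mem0v //.
  by exists (vec_of (foot2 P)); rewrite ?memv_line ?add0r.
- exists (vec_of (foot1 P)); rewrite ?memv_line //.
  by exists (vec_of (foot2 P)); rewrite ?memv_line // vec_of_feet.
Qed.

Lemma transversal_S1 : S1 :&: transversal P = [set foot1 P].
Proof.
apply/setP=> Q; rewrite in_setI in_set1 in_transversal.
apply/andP/eqP => [[QS1 /or3P[]/eqP defQ]|->]; rewrite ?eqxx ?foot1_S1 //.
  by move: (disjoint_S1_S2 QS1); rewrite defQ foot2_S2.
by move: aniso_notin_S1; rewrite -defQ QS1.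
Qed.

Lemma transversal_S2 : S2 :&: transversal P = [set foot2 P].
Proof.
apply/setP=> Q; rewrite in_setI in_set1 in_transversal.
apply/andP/eqP => [[QS2 /or3P[]/eqP defQ]|->]; rewrite ?eqxx ?orbT ?foot2_S2 //.
  by move: (disjoint_S1_S2 foot1_S1); rewrite -defQ QS2.
by move: aniso_notin_S2; rewrite -defQ QS2.
Qed.

(** A line meeting [S1] in Q1 and [S2] in Q2 is spanned by them. As [P] is on neither member, it is
    Q1 + Q2, and this decomposition is unique. *)
Lemma transversal_unique :
  unique
    (fun l => [/\ l \in lines, P \in l, l :&: S1 != set0 & l :&: S2 != set0])
    (transversal P).
Proof.
have dim_span Q1 Q2 : Q1 \in S1 -> Q2 \in S2 ->
    \dim (<[vec_of Q1]> + <[vec_of Q2]>) = 2%N.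
  rewrite !in_points_of => Q1U Q2U.
  have cap0 : (<[vec_of Q1]> :&: <[vec_of Q2]> = 0)%VS.
    by apply/eqP; rewrite -subv0 -U12 capvS // -memvE.
  have := dimv_sum_cap <[vec_of Q1]> <[vec_of Q2]>.
  by rewrite cap0 dimv0 addn0 !dim_vline !vec_of_neq0.
split=> [|l [/imsetP[L]]].
  split.
  - apply/imsetP; exists (<[vec_of (foot1 P)]> + <[vec_of (foot2 P)]>)%VS => //.
    by rewrite inE dim_span ?foot1_S1 ?foot2_S2.
  - by rewrite in_transversal; apply/or3P/Or33.
  - by rewrite setIC transversal_S1 -card_gt0 cards1.
  - by rewrite setIC transversal_S2 -card_gt0 cards1.
rewrite inE => /eqP dimL -> PL.
case/set0Pn=> Q1 /setIP[Q1L Q1S] /set0Pn[Q2 /setIP[Q2L Q2S]].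
have defL : L = (<[vec_of Q1]> + <[vec_of Q2]>)%VS.
  apply/eqP; rewrite eq_sym eqEdim dimL dim_span // leqnn andbT.
  by rewrite subv_add -!memvE -!in_points_of Q1L.
have [|def1 def2] := @feet_unique P Q1 Q2 Q1S Q2S; last first.
  by rewrite /transversal def1 def2 defL.
move: PL; rewrite in_points_of defL => /memv_addP[u uF [v vF]].
move: uF vF; rewrite !memv_line_F2.
case/orP=> /eqP-> /orP[]/eqP->; rewrite ?add0r ?addr0 // => defP.
- by have := vec_of_neq0 P; rewrite defP eqxx.
- by have := aniso_notin_S2; rewrite (vec_of_inj defP) Q2S.
- by have := aniso_notin_S1; rewrite (vec_of_inj defP) Q1S.
Qed.

End Transversal.

(** * The action on feet, and the correspondence with the ovoids *)

Local Notation G := (Gstar f S S1 S2).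

Lemma S1_neq_S2 : S1 != S2.
Proof.
pose u : bits8 := ((true, false, false, false), zero4).
have decu : decp (point_of (enc u)) = u by apply: decp_point.
apply/negP => /eqP eq12; have := decp_S1 (point_of (enc u)).
by rewrite eq12 decp_S2 decu.
Qed.

Lemma Gstar_S12 g : g \in G ->
  ([set g Q | Q in S1] = S1 /\ [set g Q | Q in S2] = S2) \/
  ([set g Q | Q in S1] = S2 /\ [set g Q | Q in S2] = S1).
Proof.
case/GstarP=> _ fam12 _; have := S1_neq_S2.
rewrite -(inj_eq (imset_inj (@perm_inj _ g))).
have := fam12 S1; have := fam12 S2; rewrite !inE !eqxx orbT.
move=> /(_ isT)/orP[]/eqP-> /(_ isT)/orP[]/eqP->; rewrite ?eqxx //; tauto.
Qed.

Lemma Gstar_addv g P Q R : g \in G ->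
  vec_of P = vec_of Q + vec_of R -> vec_of (g P) = vec_of (g Q) + vec_of (g R).
Proof.
by case/GstarP=> /PGO_P[A [_ _ vecA]] _ _; rewrite !vecA -mulmxDl => ->.
Qed.

(** Collineations respect the sum of the two feet. An element exchanging [S1] and [S2] exchanges the
    roles of the feet, so only the unordered pair is equivariant. *)
Lemma Gstar_feet g P : g \in G -> P \in anisotropic_points f ->
  [set g Q | Q in feet P] = feet (g P).
Proof.
move=> gG anisoP; rewrite /feet imsetU1 imset_set1.
have g_sum := Gstar_addv gG (vec_of_feet anisoP).
have in1 : g (foot1 P) \in [set g Q | Q in S1] by apply/imset_f/foot1_S1.
have in2 : g (foot2 P) \in [set g Q | Q in S2] by apply/imset_f/foot2_S2.
case: (Gstar_S12 gG) => -[g1 g2]; rewrite {}g1 in in1; rewrite {}g2 in in2.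
  by have [-> ->] := feet_unique in1 in2 g_sum.
rewrite addrC in g_sum; have [-> ->] := feet_unique in2 in1 g_sum.
by rewrite setUC.
Qed.

Lemma totally_isotropic_max (U : {vspace vec}) : totally_isotropic f U ->
  exists2 W, max_totally_isotropic f W & (U <= W)%VS.
Proof.
move=> isoU.
pose good (W : {vspace vec}) := totally_isotropic f W && (U <= W)%VS.
have goodU : good U by rewrite /good isoU subvv.
case: (@arg_maxnP _ U good (fun W => \dim W) goodU) => W /andP[isoW UW] maxW.
exists W => //; rewrite /max_totally_isotropic isoW /=.
apply/forallP=> V; apply/implyP => /andP[isoV WV].
by rewrite eq_sym eqEdim WV; apply: maxW; rewrite /good isoV (subv_trans UW).
Qed.

Lemma max_totally_isotropic_generator W :
  max_totally_isotropic f W -> points_of W \in generators f.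
Proof. by move=> maxW; apply/imsetP; exists W; rewrite ?inE. Qed.

Lemma spread_in_generators T : T \in S -> T \in generators f.
Proof. by case/andP: S_spread => /subsetP sub _ /sub. Qed.

(** If the points of [O] on [S1] and [S2] were perpendicular, their line would lie in a generator
    containing two points of [O]. So their sum is anisotropic. *)
Lemma ovoid_feet O : is_ovoid f O ->
  exists2 P, P \in anisotropic_points f & feet P \subset O.
Proof.
case/andP=> /subsetP isoO /forall_inP cardO.
have /eqP/cards1P[Q1 def1] := eqP (cardO _ (spread_in_generators S1_in)).
have /eqP/cards1P[Q2 def2] := eqP (cardO _ (spread_in_generators S2_in)).
have /setIP[Q1O Q1S] : Q1 \in O :&: S1 by rewrite def1 inE.
have /setIP[Q2O Q2S] : Q2 \in O :&: S2 by rewrite def2 inE.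
have f1 : f (vec_of Q1) = 0.
  by apply/eqP; rewrite -in_isotropic_points // isoO.
have f2 : f (vec_of Q2) = 0.
  by apply/eqP; rewrite -in_isotropic_points // isoO.
have neq12 : Q1 != Q2.
  by apply: contraTneq Q2S => <-; apply: disjoint_S1_S2.
have v_neq0 : vec_of Q1 + vec_of Q2 != 0.
  apply: contraNneq neq12 => v0; apply/eqP/vec_of_inj/(addIr (vec_of Q2)).
  by rewrite v0 addF2_self.
pose P := point_of (vec_of Q1 + vec_of Q2).
have def_P : vec_of P = vec_of Q1 + vec_of Q2 by rewrite point_ofK.
exists P; last first.
  rewrite /feet; have [-> ->] := feet_unique Q1S Q2S def_P.
  by apply/subsetP=> Q; rewrite !inE => /orP[]/eqP->.
rewrite inE in_isotropic_points // def_P form_add f1 f2 !add0r.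
apply/negP => /eqP polar0.
have isoL : totally_isotropic f (<[vec_of Q1]> + <[vec_of Q2]>).
  apply: totally_isotropic_add => // [|u]; last first.
    rewrite memv_line_F2 => /orP[]/eqP-> //.
    by rewrite /polar add0r (form0 f_quad) subr0 subrr.
  by have := isoO _ Q1O; rewrite inE val_point.
have [W maxW LW] := totally_isotropic_max isoL.
have /cards1P[Q defW] := cardO _ (max_totally_isotropic_generator maxW).
have inW R :
    R \in O -> vec_of R \in (<[vec_of Q1]> + <[vec_of Q2]>)%VS -> R = Q.
  move=> RO RL; apply/set1P; rewrite -defW inE RO in_points_of.
  exact: (subvP LW).
move/eqP: neq12; apply; transitivity Q.
  by apply: inW => //; rewrite memvE addvSl.
by apply/esym/inW; rewrite // memvE addvSr.
Qed.

(** Transitivity yields for each [P] some member of [Y] containing its feet, and a member contains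
    the feet of at most one [P]. The resulting injection is onto by counting, which in turn gives
    uniqueness. *)
Lemma ovoid_orbit_correspondence (Y : {set {set point}}) :
    is_ovoid_orbit f G Y -> #|Y| = 120%N ->
  exists Ov : point -> {set point},
    [/\ forall P, P \in anisotropic_points f ->
          unique (fun O => O \in Y /\ feet P \subset O) (Ov P),
        {in anisotropic_points f &, injective Ov},
        [set Ov P | P in anisotropic_points f] = Y
      & forall g P, g \in G -> P \in anisotropic_points f ->
          Ov (g P) = [set g Q | Q in Ov P]].
Proof.
case=> O0 ovoidO0 defY cardY.
have [P0 anisoP0 feetP0] := ovoid_feet ovoidO0.
have Y_im O : reflect (exists2 g, g \in G & O = [set g Q | Q in O0]) (O \in Y).
  rewrite defY; apply: (iffP imsetP) => [[g gG ->]|[g gG ->]]; exists g => //.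
have Y_g g O : g \in G -> O \in Y -> [set g Q | Q in O] \in Y.
  move=> gG /Y_im[h hG ->]; apply/Y_im; exists (h * g)%g.
    exact: groupM.
  by rewrite -imset_comp; apply: eq_imset => Q; rewrite /= permM.
(* Pulling [T] back along [g] reduces this to the ovoid [O0]. *)
have Y_S12 O T : O \in Y -> T \in [set S1; S2] -> #|O :&: T| = 1%N.
  case/Y_im=> g gG -> T12.
  have [T' T'12 <-] : exists2 T', T' \in [set S1; S2] & [set g Q | Q in T'] = T.
    move: T12; rewrite !inE; case: (Gstar_S12 gG) => -[g1 g2] /orP[]/eqP->;
      by [exists S1; rewrite ?inE ?eqxx | exists S2; rewrite ?inE ?eqxx ?orbT].
  rewrite -imsetI; last by move=> ? ? _ _; apply: perm_inj.
  rewrite card_imset; last exact: perm_inj.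
  have T'S : T' \in S by move: T'12; rewrite !inE => /orP[]/eqP->.
  by case/andP: ovoidO0 => _ /forall_inP/(_ T' (spread_in_generators T'S))/eqP.
have feet_inj O P P' : O \in Y -> P \in anisotropic_points f ->
    P' \in anisotropic_points f -> feet P \subset O -> feet P' \subset O ->
    P = P'.
  move=> OY anisoP anisoP'; rewrite /feet !subUset !sub1set.
  case/andP=> O1 O2 /andP[O1' O2']; apply: vec_of_inj.
  rewrite (vec_of_feet anisoP) (vec_of_feet anisoP').
  have /eqP/cards1P[Q1 def1] := Y_S12 O S1 OY (set21 _ _).
  have /eqP/cards1P[Q2 def2] := Y_S12 O S2 OY (set22 _ _).
  have is1 R : R \in O -> R \in S1 -> R = Q1.
    by move=> RO RS; apply/set1P; rewrite -def1 inE RO.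
  have is2 R : R \in O -> R \in S2 -> R = Q2.
    by move=> RO RS; apply/set1P; rewrite -def2 inE RO.
  rewrite (is1 _ O1 (foot1_S1 anisoP)) (is2 _ O2 (foot2_S2 anisoP)).
  by rewrite (is1 _ O1' (foot1_S1 anisoP')) (is2 _ O2' (foot2_S2 anisoP')).
have feet_g g (O : {set point}) P :
    g \in G -> P \in anisotropic_points f -> feet P \subset O ->
    feet (g P) \subset [set g Q | Q in O].
  by move=> gG anisoP PO; rewrite -(Gstar_feet gG anisoP) imsetS.
(* The default [set0] is never taken at an anisotropic point, by [OvP]. *)
pose Ov P : {set point} := odflt set0 [pick O in Y | feet P \subset O].
have OvP P : P \in anisotropic_points f -> Ov P \in Y /\ feet P \subset Ov P.
  move=> anisoP; rewrite /Ov; case: pickP => [O /andP[]//|no_O].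
  have [g gG gP0] := Gstar_transitive anisoP0 anisoP.
  have := no_O [set g Q | Q in O0]; rewrite -gP0 feet_g // andbT.
  by move/negP; case; apply/Y_im; exists g.
have Ov_inj : {in anisotropic_points f &, injective Ov}.
  move=> P P' anisoP anisoP' eqOv; have [OY PO] := OvP P anisoP.
  have [_ PO'] := OvP P' anisoP'.
  by apply: (feet_inj (Ov P)); rewrite ?eqOv // -eqOv.
have Ov_im : [set Ov P | P in anisotropic_points f] = Y.
  apply/eqP; rewrite eqEcard card_in_imset // cardY.
  rewrite card_anisotropic_points andbT.
  by apply/subsetP=> O /imsetP[P anisoP ->]; case: (OvP P anisoP).
(* By surjectivity [O] is itself some [Ov P'], and [feet_inj] then identifies [P'] with [P]. *)
have Ov_uniq P O :
    P \in anisotropic_points f -> O \in Y -> feet P \subset O -> Ov P = O.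
  rewrite -{1}Ov_im => anisoP /imsetP[P' anisoP' ->] PO.
  have [OY PO'] := OvP P' anisoP'.
  by rewrite (feet_inj (Ov P') P P').
exists Ov; split=> // [P anisoP|g P gG anisoP].
  by split=> [|O [OY PO]]; [exact: OvP | exact: Ov_uniq].
have anisogP : g P \in anisotropic_points f.
  case/GstarP: gG => /PGO_P[A [_ fA vecA]] _ _; move: anisoP.
  by rewrite !in_setC !in_isotropic_points // vecA fA.
have [OY PO] := OvP P anisoP.
(* The image of [Ov P] under [g] is in [Y] and contains the feet of [g P], so uniqueness gives
   equivariance. *)
by apply: Ov_uniq => //; [exact: Y_g | exact: feet_g].
Qed.

End Spread.

Local Close Scope ring_scope.

Theorem mainTheorem3
    (f : vec -> 'F_2)
    (f_quad : quadratic_form f) (f_nondeg : nondegenerate_form f)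
    (f_hyp : hyperbolic_form f)
    (S : {set {set point}}) (S_spread : is_spread f S)
    (S1 S2 : {set point}) (S1_in : S1 \in S) (S2_in : S2 \in S)
    (S12 : S1 <> S2)
    (Y : {set {set point}}) (Y_orbit : is_ovoid_orbit f (Gstar f S S1 S2) Y)
    (Y_card : #|Y| = 120) :
  exists (ell : point -> {set point}) (Ov : point -> {set point}),
    (forall P : point, P \in anisotropic_points f ->
       unique (fun l : {set point} =>
                 [/\ l \in lines, P \in l, l :&: S1 != set0
                   & l :&: S2 != set0])
              (ell P))
    /\ (forall P : point, P \in anisotropic_points f ->
          [/\ #|S1 :&: ell P| = 1, #|S2 :&: ell P| = 1
            & unique (fun O : {set point} =>
                        [/\ O \in Y, S1 :&: ell P \subset O
                          & S2 :&: ell P \subset O])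
                     (Ov P)])
    /\ {in anisotropic_points f &, injective Ov}
    /\ [set Ov P | P in anisotropic_points f] = Y
    /\ (forall (g : {perm point}) (P : point),
          g \in Gstar f S S1 S2 -> P \in anisotropic_points f ->
          Ov (g P) = [set g Q | Q in Ov P]).
Proof.
have [U1 max1 defS1] := spread_generator S_spread S1_in.
have [U2 max2 defS2] := spread_generator S_spread S2_in.
rewrite {S1}defS1 {S2}defS2 in S1_in S2_in S12 Y_orbit *.
have U12 := spread_capv S_spread S1_in S2_in S12.
have dimU2 := dim_generator f_quad f_nondeg f_hyp max2.
have [enc [[dec encK decK] encD f_enc enc1 enc2]] :=
  hyperbolic_bit_coordinates f_quad f_nondeg f_hyp max1 max2 U12.
have [Ov [Ov_unique Ov_inj Ov_im Ov_equiv]] := ovoid_orbit_correspondence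
  f_quad f_nondeg f_hyp S_spread S1_in S2_in dimU2 encK decK encD f_enc enc1
  enc2 Y_orbit Y_card.
exists (transversal enc dec), Ov; split; last split; last by [].
  move=> P.
  exact: (transversal_unique f_quad U12 encK decK encD f_enc enc1 enc2).
move=> P anisoP.
(* Both intersections are singletons of feet, so containing them means containing [feet P]. *)
rewrite (transversal_S1 f_quad encK decK encD f_enc enc1 enc2 anisoP).
rewrite (transversal_S2 f_quad encK decK encD f_enc enc1 enc2 anisoP) !cards1.
have [[OY PO] Ov_P] := Ov_unique P anisoP; split=> //.
split=> [|O [OY' O1 O2]]; last by apply: Ov_P; rewrite /feet subUset O1 O2.
by move: PO; rewrite /feet subUset => /andP[].
Qed.
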